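(* Let $G$ be a countable, infinite, discrete group and let $B\subseteq G$. Then $B$ is shattered by $\mathfrak{B}$ if and only if $B$ is small. Moreover, if $B$ is small, then there exists a minimal subshift $X\subseteq\Omega$ which shatters $B$.
   Context: $\Omega=\{0,1\}^G$ with the action $(g\cdot z)(h)=z(hg)$, identified with the Boolean ring of subsets of $G$ (symmetric difference and intersection). A subshift is a closed $G$-invariant subset of $\Omega$. A point $u\in\Omega$ is minimal if $\overline{G\cdot u}$ is a minimal subshift (every orbit dense). $\mathfrak{B}\subseteq\Omega$ is the subring generated by all minimal points. A set $X\subseteq\Omega$ shatters $B\subseteq G$ if for every $C\subseteq B$ there is $x\in X$ with $x|_B=1_C$. A set $B\subseteq G$ is small if the only minimal subflow of $\overline{G\cdot 1_B}\subseteq\Omega$ is $\{1_\emptyset\}$; equivalently, for every finite $F\subseteq G$ the set $\{g\in G:Fg\cap B=\emptyset\}$ is syndetic (a set $S$ is syndetic if $FS=G$ for some finite $F$). *)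

(* Defs.v *)
(* Abstract (possibly infinite) discrete groups are given as an
   explicit record; Omega = {0,1}^G is modelled as G -> bool with the product
   topology (basic open sets = cylinders over finite subsets of G). *)
From Stdlib Require Import List.
Import ListNotations.

Record group := Group {
  gcar :> Type;
  gmul : gcar -> gcar -> gcar;
  gone : gcar;
  ginv : gcar -> gcar;
  gmulA : forall x y z, gmul x (gmul y z) = gmul (gmul x y) z;
  gmul1g : forall x, gmul gone x = x;
  gmulVg : forall x, gmul (ginv x) x = gone
}.

Section Defs.
Variable G : group.

Definition countable_group : Prop :=
  exists f : nat -> G, forall g : G, exists n, f n = g.
Definition infinite_group : Prop :=
  forall l : list G, exists g : G, ~ In g l.

(* Omega = {0,1}^G, identified with subsets of G. *)
Definition Omega := G -> bool.

Definition act (g : G) (z : Omega) : Omega := fun h => z (gmul G h g).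

Definition agree_on (F : list G) (x z : Omega) : Prop :=
  forall h, In h F -> x h = z h.

Definition closure (S : Omega -> Prop) : Omega -> Prop :=
  fun z => forall F : list G, exists s, S s /\ agree_on F s z.

Definition closed (X : Omega -> Prop) : Prop :=
  forall z, closure X z -> X z.

Definition invariant (X : Omega -> Prop) : Prop :=
  forall g x, X x -> X (act g x).

Definition subshift (X : Omega -> Prop) : Prop := closed X /\ invariant X.

Definition orbit (u : Omega) : Omega -> Prop :=
  fun y => exists g, y = act g u.

Definition minimal_subshift (X : Omega -> Prop) : Prop :=
  subshift X /\ (exists x, X x) /\
  forall x, X x -> forall y, X y -> closure (orbit x) y.

Definition minimal_point (u : Omega) : Prop :=
  minimal_subshift (closure (orbit u)).

Definition oadd (x y : Omega) : Omega := fun h => xorb (x h) (y h).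
Definition omul (x y : Omega) : Omega := fun h => andb (x h) (y h).

Inductive frakB : Omega -> Prop :=
  | frakB_gen u : minimal_point u -> frakB u
  | frakB_zero : frakB (fun _ => false)
  | frakB_one : frakB (fun _ => true)
  | frakB_add x y : frakB x -> frakB y -> frakB (oadd x y)
  | frakB_mul x y : frakB x -> frakB y -> frakB (omul x y).

Definition shatters (X : Omega -> Prop) (B : Omega) : Prop :=
  forall C : Omega, (forall h, C h = true -> B h = true) ->
  exists x, X x /\ forall h, B h = true -> x h = C h.

Definition small (B : Omega) : Prop :=
  forall X : Omega -> Prop,
    (forall x, X x -> closure (orbit B) x) -> minimal_subshift X ->
    forall x, X x <-> x = (fun _ => false).

End Defs.

(* Main.v *)
(** The key fact is a consequence of the Lovász local lemma: for an infinite set R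
    of return times of a minimal point c to a window W, there are a finite D in R and
    z in Omega such that every translate D g contains an s at which z shows a pattern
    P s prescribed in advance.  Iterating over minimal flows X_1, ..., X_n and a
    nonzero minimal flow Y, and each time trading knowledge of the point of X_k for
    the knowledge that some translate of it looks like c on W, one finds a finite
    pattern z which, masked by a point of Y, is not of the form p(x_1, ..., x_n).  If B
    is not small, a minimal Y <> {0} lies in its orbit closure, and a subset C of B
    that shows all masked patterns along copies of Y inside B agrees on B with no
    element of the ring.

    Conversely, if B is small, start from Omega and enforce, one pattern after the
    other, that a pattern occurring in the current subshift occurs syndetically.
    Strong irreducibility survives each step, and so does shattering of B, because
    the set of places far away from B is syndetic.  The intersection is minimal. *)

Require Import Defs.
From Stdlib Require Import List FinFun Arith Cantor Lia Reals Lra.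
From Stdlib Require Import Classical ClassicalEpsilon FunctionalExtensionality.
Import ListNotations.

Lemma eq_decide {T : Type} (x y : T) : {x = y} + {x <> y}.
Proof. apply excluded_middle_informative. Qed.

(** * The local lemma for fair coins *)

Section CoinTossing.
Open Scope R_scope.
Variable T : Type.

Definition update (z : T -> bool) (v : T) (b : bool) : T -> bool :=
  fun t => if eq_decide t v then b else z t.

(* The mean of [phi] over all ways of resampling [z] at the points of [V]. *)
Fixpoint expect (V : list T) (phi : (T -> bool) -> R) (z : T -> bool) : R :=
  match V with
  | [] => phi z
  | v :: V' => (expect V' phi (update z v true) + expect V' phi (update z v false)) / 2
  end.

Definition depends_on (S : T -> Prop) (phi : (T -> bool) -> R) : Prop :=
  forall z z', (forall t, S t -> z t = z' t) -> phi z = phi z'.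

Lemma update_agree (S : T -> Prop) z z' v b :
  (forall t, S t -> z t = z' t) -> forall t, S t -> update z v b t = update z' v b t.
Proof. intros H t Ht. unfold update. destruct (eq_decide t v); auto. Qed.

Lemma update_outside (S : T -> Prop) z v b :
  ~ S v -> forall t, S t -> update z v b t = z t.
Proof. intros H t Ht. unfold update. destruct (eq_decide t v); subst; tauto. Qed.

Lemma expect_le V phi psi z :
  (forall z, phi z <= psi z) -> expect V phi z <= expect V psi z.
Proof.
  intros H. revert z. induction V as [|v V IH]; intros z; simpl; auto.
  pose proof (IH (update z v true)). pose proof (IH (update z v false)). lra.
Qed.

Lemma expect_ext V phi psi z :
  (forall z, phi z = psi z) -> expect V phi z = expect V psi z.
Proof.
  intros H. apply Rle_antisym; apply expect_le; intros; rewrite H; lra.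
Qed.

Lemma expect_const V c z : expect V (fun _ => c) z = c.
Proof.
  revert z. induction V as [|v V IH]; intros z; simpl; auto. rewrite !IH. lra.
Qed.

Lemma expect_sub V phi psi z :
  expect V (fun z => phi z - psi z) z = expect V phi z - expect V psi z.
Proof.
  revert z. induction V as [|v V IH]; intros z; simpl; auto. rewrite !IH. lra.
Qed.

Lemma expect_depends V S phi : depends_on S phi -> depends_on S (expect V phi).
Proof.
  intros H. induction V as [|v V IH]; simpl; auto. intros z z' Hz.
  rewrite (IH (update z v true) (update z' v true)) by (apply update_agree; auto).
  rewrite (IH (update z v false) (update z' v false)) by (apply update_agree; auto).
  reflexivity.
Qed.

Lemma expect_outside V S phi z :
  depends_on S phi -> (forall t, In t V -> ~ S t) -> expect V phi z = phi z.
Proof.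
  intros Hp. revert z. induction V as [|v V IH]; intros z H; simpl; auto.
  rewrite !IH by (intros; apply H; right; auto).
  rewrite (Hp (update z v true) z) by (apply update_outside; apply H; left; auto).
  rewrite (Hp (update z v false) z) by (apply update_outside; apply H; left; auto).
  lra.
Qed.

(** Independence: each resampled point lies outside [S] or outside [S'], so the resampling leaves
    one of the two factors unchanged. *)
Lemma expect_mul V S S' phi psi z :
  depends_on S phi -> depends_on S' psi -> (forall t, S t -> S' t -> False) ->
  expect V (fun z => phi z * psi z) z = expect V phi z * expect V psi z.
Proof.
  intros Hp Hq Hd. revert z. induction V as [|v V IH]; intros z; simpl; auto.
  rewrite !IH. destruct (classic (S v)) as [Hv|Hv].
  - assert (Hv' : ~ S' v) by (intro; eauto).
    rewrite (expect_depends V S' psi Hq (update z v true) z) by (apply update_outside; auto).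
    rewrite (expect_depends V S' psi Hq (update z v false) z) by (apply update_outside; auto).
    lra.
  - rewrite (expect_depends V S phi Hp (update z v true) z) by (apply update_outside; auto).
    rewrite (expect_depends V S phi Hp (update z v false) z) by (apply update_outside; auto).
    lra.
Qed.

Definition coin (v : T) (b : bool) (z : T -> bool) : R :=
  if Bool.eqb (z v) b then 1 else 0.

Lemma coin_depends v b : depends_on (eq v) (coin v b).
Proof. intros z z' H. unfold coin. rewrite (H v); auto. Qed.

(** [V] may repeat [v]; the last occurrence overrides the earlier ones. *)
Lemma expect_coin V v b z : In v V -> expect V (coin v b) z = 1 / 2.
Proof.
  revert z. induction V as [|u V IH]; intros z Hv; simpl; [destruct Hv|].
  destruct (classic (In v V)) as [Hi|Hi].
  - rewrite !IH by auto. lra.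
  - destruct Hv as [->|]; [|tauto].
    rewrite !(expect_outside V (eq v)) by (try apply coin_depends; intros; congruence).
    unfold coin, update. destruct (eq_decide v v); [|tauto]. destruct b; simpl; lra.
Qed.

Fixpoint matches (L : list T) (P z : T -> bool) : R :=
  match L with
  | [] => 1
  | v :: L' => coin v (P v) z * matches L' P z
  end.

Lemma matches_depends L P : depends_on (fun t => In t L) (matches L P).
Proof.
  induction L as [|v L IH]; simpl; intros z z' H; auto.
  rewrite (IH z z') by auto. rewrite (coin_depends v (P v) z z'); auto.
Qed.

Lemma matches_01 L P z : matches L P z = 1 \/ matches L P z = 0.
Proof.
  induction L as [|v L IH]; simpl; auto.
  unfold coin. destruct (Bool.eqb (z v) (P v)), IH as [-> | ->]; lra.
Qed.

Lemma matches_1 L P z : matches L P z = 1 -> forall v, In v L -> z v = P v.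
Proof.
  induction L as [|u L IH]; simpl; [tauto|].
  unfold coin. destruct (Bool.eqb (z u) (P u)) eqn:E; intros H; [|lra].
  apply Bool.eqb_prop in E. intros v [<-|Hv]; auto. apply IH; auto. lra.
Qed.

Lemma expect_matches V L P z :
  NoDup L -> incl L V -> expect V (matches L P) z = (1 / 2) ^ length L.
Proof.
  induction L as [|v L IH]; intros Hn Hi; [exact (expect_const V 1 z)|].
  simpl. inversion Hn; subst.
  rewrite (expect_mul V (eq v) (fun t => In t L)).
  - rewrite expect_coin by (apply Hi; left; auto).
    rewrite IH; auto. intros t Ht; apply Hi; right; auto.
  - apply coin_depends.
  - apply matches_depends.
  - intros t <-; auto.
Qed.

Section Misses.
Variables (J : Type) (loc : J -> list T) (pat : J -> T -> bool).

Fixpoint misses (ds : list J) (z : T -> bool) : R :=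
  match ds with
  | [] => 1
  | d :: ds' => (1 - matches (loc d) (pat d) z) * misses ds' z
  end.

Lemma misses_depends ds :
  depends_on (fun t => exists d, In d ds /\ In t (loc d)) (misses ds).
Proof.
  induction ds as [|d ds IH]; simpl; intros z z' H; auto.
  rewrite (IH z z') by (intros t (d' & ? & ?); apply H; eauto).
  rewrite (matches_depends (loc d) (pat d) z z') by (intros t Ht; apply H; eauto).
  reflexivity.
Qed.

Lemma misses_01 ds z : misses ds z = 1 \/ misses ds z = 0.
Proof.
  induction ds as [|d ds IH]; simpl; auto.
  destruct (matches_01 (loc d) (pat d) z) as [-> | ->], IH as [-> | ->]; lra.
Qed.

Lemma misses_0 ds z :
  misses ds z = 0 -> exists d, In d ds /\ forall v, In v (loc d) -> z v = pat d v.
Proof.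
  induction ds as [|d ds IH]; simpl; [lra|]. intros H.
  destruct (matches_01 (loc d) (pat d) z) as [E|E]; rewrite E in H.
  - exists d. split; auto. apply matches_1; auto.
  - destruct IH as (d' & ? & ?); [lra|]. eauto.
Qed.

Lemma expect_misses V ds m z :
  NoDup ds ->
  (forall d, In d ds -> NoDup (loc d) /\ incl (loc d) V /\ length (loc d) = m) ->
  (forall d d' t, In d ds -> In d' ds -> In t (loc d) -> In t (loc d') -> d = d') ->
  expect V (misses ds) z = (1 - (1 / 2) ^ m) ^ length ds.
Proof.
  induction ds as [|d ds IH]; intros Hn Hl Hd; [exact (expect_const V 1 z)|].
  simpl. inversion Hn; subst.
  rewrite (expect_mul V (fun t => In t (loc d))
             (fun t => exists d, In d ds /\ In t (loc d))).
  - rewrite expect_sub, expect_const.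
    destruct (Hl d) as (? & ? & Hm); [left; auto|].
    rewrite expect_matches, Hm by auto. rewrite IH; auto.
    + intros; apply Hl; right; auto.
    + intros; eapply Hd; eauto; right; auto.
  - intros z1 z2 Hz. rewrite (matches_depends (loc d) (pat d) z1 z2); auto.
  - apply misses_depends.
  - intros t Ht (d' & Hd' & Ht').
    assert (d = d') by (eapply Hd; eauto; [left|right]; auto). subst. tauto.
Qed.

End Misses.

(** * The symmetric local lemma for events [chi i] supported on [sup i] *)

Section LocalLemma.
Variables (I : Type) (V : list T) (z0 : T -> bool)
  (chi : I -> (T -> bool) -> R) (sup : I -> T -> Prop) (Gamma : list I) (p : R) (Delta : nat).
Hypothesis chi_range : forall i z, 0 <= chi i z <= 1.
Hypothesis chi_depends : forall i, depends_on (sup i) (chi i).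
Hypothesis chi_prob : forall i, In i Gamma -> expect V (chi i) z0 <= p.
Hypothesis few_neighbours : forall i L, NoDup L ->
  (forall j, In j L -> exists t, sup i t /\ sup j t) -> (length L <= Delta)%nat.
Hypothesis p_small : 4 * p * INR Delta <= 1.
Hypothesis p_nonneg : 0 <= p.
Hypothesis p_half : 2 * p < 1.

Fixpoint good (S : list I) (z : T -> bool) : R :=
  match S with
  | [] => 1
  | i :: S' => (1 - chi i z) * good S' z
  end.

Lemma good_range S z : 0 <= good S z <= 1.
Proof.
  induction S as [|i S IH]; simpl; [lra|]. pose proof (chi_range i z). nra.
Qed.

Lemma good_depends S : depends_on (fun t => exists i, In i S /\ sup i t) (good S).
Proof.
  induction S as [|i S IH]; simpl; intros z z' H; auto.
  rewrite (IH z z') by (intros t (j & ? & ?); apply H; eauto).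
  rewrite (chi_depends i z z') by eauto. reflexivity.
Qed.

Lemma good_filter (b : I -> bool) S z :
  good S z = good (filter b S) z * good (filter (fun i => negb (b i)) S) z.
Proof.
  induction S as [|i S IH]; simpl; [lra|].
  destruct (b i); simpl; rewrite IH; ring.
Qed.

(** A union bound over [S1], weighted by [good S2]: each factor [1 - chi j] removes at most the mass
    of [chi j]. *)
Lemma good_union_bound S1 S2 c :
  (forall j, In j S1 -> expect V (fun z => chi j z * good S2 z) z0 <= c) ->
  expect V (good S2) z0 - INR (length S1) * c <=
  expect V (fun z => good S1 z * good S2 z) z0.
Proof.
  induction S1 as [|i S1 IH]; intros H.
  - simpl. rewrite (expect_ext V (fun z => 1 * good S2 z) (good S2)) by (intros; ring). lra.
  - assert (Hi := H i (or_introl eq_refl)).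
    specialize (IH (fun j Hj => H j (or_intror Hj))).
    cbn [length]. rewrite S_INR.
    apply Rle_trans with
      (expect V (fun z => good S1 z * good S2 z - chi i z * good S2 z) z0).
    + rewrite expect_sub. lra.
    + apply expect_le. intros z. simpl.
      pose proof (good_range S1 z). pose proof (good_range S2 z).
      pose proof (chi_range i z).
      assert (0 <= (chi i z * good S2 z) * (1 - good S1 z)).
      { apply Rmult_le_pos; [apply Rmult_le_pos|]; lra. }
      nra.
Qed.

(* Conditioned on any other bad events not happening, [chi i] has probability
   at most [2p]; division-free form. *)
Lemma conditional_bound n : forall S i,
  In i Gamma -> incl S Gamma -> NoDup S -> (length S <= n)%nat ->
  expect V (fun z => chi i z * good S z) z0 <= 2 * p * expect V (good S) z0.
Proof.
  induction n as [n IHn] using lt_wf_ind. intros S i Hi Hin HS Hn.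
  (* [S1] collects the neighbours of [i]; the events in [S2] share no coin with [i]. *)
  set (b := fun j => if excluded_middle_informative (exists t, sup i t /\ sup j t)
                     then true else false).
  set (S1 := filter b S). set (S2 := filter (fun j => negb (b j)) S).
  assert (HS2 : forall S', expect V (good S') z0 >= 0).
  { intros S'. apply Rle_ge. rewrite <- (expect_const V 0 z0). apply expect_le.
    intros; apply good_range. }
  assert (H1 : expect V (fun z => chi i z * good S z) z0 <= p * expect V (good S2) z0).
  { apply Rle_trans with (expect V (fun z => chi i z * good S2 z) z0).
    - apply expect_le. intros z. rewrite (good_filter b S). fold S1 S2.
      pose proof (good_range S1 z). pose proof (good_range S2 z).
      pose proof (chi_range i z).
      assert (0 <= (chi i z * good S2 z) * (1 - good S1 z)).
      { apply Rmult_le_pos; [apply Rmult_le_pos|]; lra. }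
      nra.
    - rewrite (expect_mul V (sup i) (fun t => exists j, In j S2 /\ sup j t)).
      + apply Rmult_le_compat_r; [specialize (HS2 S2); lra|auto].
      + apply chi_depends.
      + apply good_depends.
      + intros t Ht (j & Hj & Ht'). unfold S2 in Hj. apply filter_In in Hj.
        destruct Hj as [_ Hj]. unfold b in Hj.
        destruct (excluded_middle_informative _) as [|E]; [discriminate|].
        apply E; eauto. }
  (* If [S1] is nonempty, [S2] is shorter than [S], so by induction each of the at most [Delta]
     neighbours costs [2 * p] of the mass of [S2], together at most half of it. *)
  assert (H2 : expect V (good S2) z0 <= 2 * expect V (good S) z0).
  { destruct (eq_decide S1 []) as [E|E].
    - rewrite (expect_ext V (good S) (good S2)).
      + specialize (HS2 S2). lra.
      + intros z. rewrite (good_filter b S). fold S1 S2. rewrite E. simpl. ring.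
    - rewrite (expect_ext V (good S) (fun z => good S1 z * good S2 z))
        by (intros; apply good_filter).
      assert (Hlen : (length S1 + length S2 = length S)%nat).
      { unfold S1, S2. apply filter_length. }
      assert (length S1 <> 0)%nat by (destruct S1; simpl; congruence).
      pose proof (good_union_bound S1 S2 (2 * p * expect V (good S2) z0)) as U.
      assert (HD : (length S1 <= Delta)%nat).
      { apply (few_neighbours i); [apply NoDup_filter; auto|].
        intros j Hj. apply filter_In in Hj. destruct Hj as [_ Hj]. unfold b in Hj.
        destruct (excluded_middle_informative _); auto. discriminate. }
      apply le_INR in HD. specialize (HS2 S2).
      assert (Hu : expect V (good S2) z0 - INR (length S1) * (2 * p * expect V (good S2) z0)
                   <= expect V (fun z => good S1 z * good S2 z) z0).
      { apply U. intros j Hj. apply filter_In in Hj.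
        apply (IHn (length S2)); [lia|apply Hin; tauto| |apply NoDup_filter; auto|lia].
        intros k Hk. apply filter_In in Hk. apply Hin. tauto. }
      assert (p * INR (length S1) <= p * INR Delta) by (apply Rmult_le_compat_l; auto).
      assert (0 <= (1 / 4 - p * INR (length S1)) * expect V (good S2) z0).
      { apply Rmult_le_pos; lra. }
      nra. }
  nra.
Qed.

(** Adding an event to [S] keeps at least the fraction [1 - 2 * p] of the mass. *)
Lemma local_lemma S : NoDup S -> incl S Gamma -> 0 < expect V (good S) z0.
Proof.
  induction S as [|i S IH]; intros Hn Hi; simpl.
  - rewrite expect_const. lra.
  - inversion Hn; subst. apply incl_cons_inv in Hi. destruct Hi as [Hi HS].
    specialize (IH H2 HS).
    rewrite (expect_ext V _ (fun z => good S z - chi i z * good S z)) by (intros; ring).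
    rewrite expect_sub. pose proof (conditional_bound _ S i Hi HS H2 (le_n _)). nra.
Qed.

End LocalLemma.

Lemma expect_pos V phi z0 : 0 < expect V phi z0 -> exists z, 0 < phi z.
Proof.
  intros H. apply NNPP. intros Hn.
  assert (expect V phi z0 <= expect V (fun _ => 0) z0).
  { apply expect_le. intros z. apply Rnot_lt_le. intro; apply Hn; eauto. }
  rewrite expect_const in *. lra.
Qed.

End CoinTossing.

(** With [d = 1 - q], [q * (1 + d) <= 1] and the Bernoulli inequality give [q ^ k * (k * d) <= 1].
    The fourth power of this, at [N = 4 * k], beats the factor [N ^ 2]. *)
Lemma quadratic_times_geometric (q a : R) : (0 <= q < 1 -> 0 <= a ->
  exists N : nat, (0 < N)%nat /\ a * INR N ^ 2 * q ^ N <= 1)%R.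
Proof.
  intros Hq Ha. set (d := (1 - q)%R).
  assert (Hd : (0 < d)%R) by (unfold d; lra).
  assert (Hd4 : (0 < d ^ 4)%R) by (apply pow_lt; auto).
  destruct (INR_unbounded ((16 * a + 1) / d ^ 4)) as [k Hk].
  assert (Hkd : (16 * a + 1 < INR k * d ^ 4)%R).
  { apply (Rmult_lt_compat_r (d ^ 4)) in Hk; auto.
    unfold Rdiv in Hk. rewrite Rmult_assoc, Rinv_l in Hk; lra. }
  assert (Hk0 : (0 < k)%nat).
  { destruct k; [|lia]. simpl in Hkd. lra. }
  assert (Hk1 : (1 <= INR k)%R) by (apply (le_INR 1); lia).
  exists (4 * k)%nat. split; [lia|].
  set (u := (q ^ k)%R). assert (Hu : (0 <= u)%R) by (apply pow_le; lra).
  assert (Huk : (u * (INR k * d) <= 1)%R).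
  { apply Rle_trans with (q ^ k * (1 + d) ^ k)%R.
    - apply Rmult_le_compat_l; auto. pose proof (poly k d Hd). lra.
    - rewrite <- Rpow_mult_distr. replace 1%R with (1 ^ k)%R at 2 by apply pow1.
      apply pow_incr.
      replace (q * (1 + d))%R with (1 - (1 - q) * (1 - q))%R by (unfold d; ring).
      pose proof (Rle_0_sqr (1 - q)) as Hs. unfold Rsqr in Hs.
      assert ((1 - q) * (1 - q) <= 1 * 1)%R by (apply Rmult_le_compat; lra).
      split; lra. }
  assert (H4 : ((u * (INR k * d)) ^ 4 <= 1)%R).
  { rewrite <- (pow1 4). apply pow_incr. split; auto.
    apply Rmult_le_pos; auto. nra. }
  replace (q ^ (4 * k))%R with (u ^ 4)%R
    by (unfold u; rewrite <- pow_mult; f_equal; lia).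
  replace (INR (4 * k)) with (4 * INR k)%R
    by (rewrite mult_INR; change (INR 4) with (1 + 1 + 1 + 1)%R; ring).
  set (X := (a * (4 * INR k) ^ 2 * u ^ 4)%R).
  assert (HX : (X * (INR k * (INR k * d ^ 4)) <= 16 * a)%R).
  { replace (X * (INR k * (INR k * d ^ 4)))%R
      with (16 * a * (u * (INR k * d)) ^ 4)%R by (unfold X; ring).
    rewrite <- (Rmult_1_r (16 * a)) at 2. apply Rmult_le_compat_l; lra. }
  assert (HX0 : (0 <= X)%R).
  { unfold X. repeat apply Rmult_le_pos; auto using pow_le; try lra. }
  apply Rnot_lt_le. intros HX1.
  assert (16 * a + 1 < INR k * (INR k * d ^ 4))%R by nra. nra.
Qed.

(** * Patterns and minimal flows *)

Section Dynamics.
Variable G : group.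
Local Notation "x * y" := (gmul G x y).
Local Notation "x ^-1" := (ginv G x) (at level 30, format "x ^-1").
Local Notation "1" := (gone G).

Lemma gmulgV (x : G) : x * x^-1 = 1.
Proof.
  rewrite <- (gmul1g G (x * x^-1)), <- (gmulVg G (x^-1)).
  rewrite <- gmulA, (gmulA G (x^-1) x), gmulVg, gmul1g. reflexivity.
Qed.

Lemma gmulg1 (x : G) : x * 1 = x.
Proof. rewrite <- (gmulVg G x), gmulA, gmulgV, gmul1g. reflexivity. Qed.

Lemma gmulKg (x y : G) : x^-1 * (x * y) = y.
Proof. rewrite gmulA, gmulVg, gmul1g. reflexivity. Qed.

Lemma gmulgK (x y : G) : x * y * y^-1 = x.
Proof. rewrite <- gmulA, gmulgV, gmulg1. reflexivity. Qed.

Lemma gmulIg (x y z : G) : x * z = y * z -> x = y.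
Proof. intros H. rewrite <- (gmulgK x z), H. apply gmulgK. Qed.

Definition lmul (A B : list G) : list G := flat_map (fun a => map (gmul G a) B) A.
Definition linv (A : list G) : list G := map (ginv G) A.

Lemma in_lmul A B a b : In a A -> In b B -> In (a * b) (lmul A B).
Proof. intros Ha Hb. apply in_flat_map. exists a. split; auto. apply in_map; auto. Qed.

Lemma in_linv A a : In a A -> In (a^-1) (linv A).
Proof. apply in_map. Qed.

Lemma length_lmul A B : length (lmul A B) = (length A * length B)%nat.
Proof. induction A as [|a A IH]; simpl; auto. rewrite length_app, length_map, IH. reflexivity. Qed.

(** Greedy choice: the next element of [R] is taken outside the finite set of products in [linv W],
    [W] and [D], which keeps the windows disjoint. *)
Lemma spread_out (R : G -> Prop) (W : list G) (N : nat) :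
  (forall l, exists g, R g /\ ~ In g l) ->
  exists D, length D = N /\ NoDup D /\ (forall d, In d D -> R d) /\
    forall d d' w w', In d D -> In d' D -> In w W -> In w' W -> w * d = w' * d' -> d = d'.
Proof.
  intros HR. induction N as [|N (D & Hl & Hn & HD & Hs)].
  - exists []. repeat split; try constructor; simpl; tauto.
  - destruct (HR (D ++ lmul (linv W) (lmul W D))) as (d0 & Hd0 & Hnew).
    assert (Hfar : forall d w w', In d D -> In w W -> In w' W -> w * d0 = w' * d -> False).
    { intros d w w' Hd Hw Hw' E. apply Hnew, in_or_app. right.
      rewrite <- (gmulKg w d0), E. auto using in_lmul, in_linv. }
    exists (d0 :: D). repeat split.
    + simpl. congruence.
    + constructor; auto. intro; apply Hnew, in_or_app; auto.
    + intros d [<-|]; auto.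
    + intros d d' w w' [<-|Hd] [<-|Hd'] Hw Hw' E; eauto; exfalso; eauto.
Qed.

(* The values of [z] on the windows [W (d g)] are independent fair coins, so the
   event that [z] misses all the prescribed patterns at [D g] has probability
   exponentially small in [length D] and meets quadratically many others. *)
Lemma prescribed_patterns (R : G -> Prop) (W : list G) :
  (forall l, exists g, R g /\ ~ In g l) ->
  exists D, (forall d, In d D -> R d) /\
    forall (Gamma : list G) (P : G -> Omega G), exists z : Omega G,
      forall g, In g Gamma -> exists d, In d D /\
        forall w, In w W -> z (w * (d * g)) = P (d * g) w.
Proof.
  intros HR. set (W' := nodup eq_decide W). set (m := length W').
  set (q := (1 - (1 / 2) ^ m)%R).
  assert (Hm : (0 < (1 / 2) ^ m <= 1)%R).
  { split; [apply pow_lt; lra|].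
    replace 1%R with (1 ^ m)%R at 2 by apply pow1. apply pow_incr. lra. }
  assert (Ha : (0 <= 4 * INR m ^ 2 + 4)%R) by (pose proof (pow2_ge_0 (INR m)); lra).
  (* The term [4 * INR m ^ 2] pays for the [N * m * m * N] neighbours of an event; the summand [4]
     gives [2 * q ^ N < 1]. *)
  destruct (quadratic_times_geometric q (4 * INR m ^ 2 + 4)) as (N & HN & Hq);
    [unfold q; lra|auto|].
  destruct (spread_out R W' N HR) as (D & HDl & HDn & HD & HDs).
  exists D. split; auto. intros Gamma P.
  set (loc := fun g d => map (fun w => w * (d * g)) W').
  set (pat := fun g d (t : G) => P (d * g) (t * (d * g)^-1)).
  set (Gam := nodup eq_decide Gamma).
  set (V := lmul W' (lmul D Gam)).
  set (z0 := fun _ : G => true).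
  set (chi := fun g => misses G G (loc g) (pat g) D).
  assert (Hq0 : (0 <= q ^ N)%R) by (apply pow_le; unfold q; lra).
  assert (HN1 : (1 <= INR N)%R) by (apply (le_INR 1); lia).
  assert (Hm0 : (0 <= INR m)%R) by apply pos_INR.
  assert (HL : (0 < expect G V (good G G chi Gam) z0)%R).
  { apply (local_lemma G G V z0 chi (fun g t => exists d, In d D /\ In t (loc g d)) Gam
             (q ^ N) (N * (m * (m * (N * 1))))); auto.
    - intros g z. unfold chi.
      destruct (misses_01 G G (loc g) (pat g) D z) as [-> | ->]; lra.
    - intros g. apply misses_depends.
    - intros g Hg. unfold chi. rewrite (expect_misses _ _ _ _ _ _ m); auto.
      + rewrite HDl. apply Rle_refl.
      + intros d Hd. repeat split.
        * apply Injective_map_NoDup; [|apply NoDup_nodup].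
          intros x y E. apply (gmulIg _ _ (d * g)). exact E.
        * intros t Ht. apply in_map_iff in Ht. destruct Ht as (w & <- & Hw).
          apply in_lmul; auto. apply in_lmul; auto.
        * apply length_map.
      + intros d d' t Hd Hd' Ht Ht'.
        apply in_map_iff in Ht. destruct Ht as (w & E & Hw).
        apply in_map_iff in Ht'. destruct Ht' as (w' & E' & Hw').
        apply (HDs d d' w w'); auto. apply (gmulIg _ _ g).
        rewrite <- !gmulA. congruence.
    - intros g L HLn HL. rewrite <- HDl.
      replace (length D * (m * (m * (length D * 1))))%nat with
        (length (lmul (linv D) (lmul (linv W') (lmul W' (lmul D [g]))))).
      2:{ rewrite !length_lmul. unfold linv. rewrite !length_map. reflexivity. }
      apply NoDup_incl_length; auto. intros h Hh.
      destruct (HL h Hh) as (t & (d & Hd & Ht) & (d' & Hd' & Ht')).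
      apply in_map_iff in Ht. destruct Ht as (w & E & Hw).
      apply in_map_iff in Ht'. destruct Ht' as (w' & E' & Hw').
      replace h with (d'^-1 * (w'^-1 * (w * (d * g)))).
      + repeat apply in_lmul; auto using in_linv. left; auto.
      + rewrite E, <- E', !gmulKg. reflexivity.
    - rewrite !mult_INR. change (INR 1) with 1%R.
      replace (4 * q ^ N * (INR N * (INR m * (INR m * (INR N * 1)))))%R with
        (4 * INR m ^ 2 * INR N ^ 2 * q ^ N)%R by ring.
      assert (0 <= INR N ^ 2 * q ^ N)%R by (apply Rmult_le_pos; auto using pow2_ge_0).
      nra.
    - assert (1 <= INR N ^ 2)%R by nra.
      assert (0 <= (INR N ^ 2 - 1) * q ^ N)%R by (apply Rmult_le_pos; lra).
      assert (0 <= INR m ^ 2 * (INR N ^ 2 * q ^ N))%R.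
      { apply Rmult_le_pos; [apply pow2_ge_0|apply Rmult_le_pos; auto using pow2_ge_0]. }
      nra.
    - apply NoDup_nodup.
    - intros x; auto. }
  apply expect_pos in HL. destruct HL as (z & Hz). exists z. intros g Hg.
  assert (Hin : In g Gam) by (apply nodup_In; auto).
  assert (Hc : chi g z = 0%R).
  { unfold chi. destruct (misses_01 G G (loc g) (pat g) D z) as [E|E]; auto. exfalso.
    revert Hz Hin. generalize Gam. intros S. induction S as [|i S IH]; simpl; auto.
    intros Hz [->|Hi].
    - fold (chi g) in E. rewrite E in Hz. lra.
    - apply IH; auto. unfold chi in Hz at 1.
      destruct (misses_01 G G (loc i) (pat i) D z) as [E'|E']; rewrite E' in Hz; lra. }
  apply misses_0 in Hc. destruct Hc as (d & Hd & Hm'). exists d. split; auto.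
  intros w Hw. rewrite Hm'.
  - unfold pat. rewrite gmulgK. reflexivity.
  - apply in_map_iff. exists w. split; auto. apply nodup_In; auto.
Qed.

(** * The shift action and orbit closures *)

Lemma act_act (a b : G) (z : Omega G) : act G a (act G b z) = act G (a * b) z.
Proof. extensionality h. unfold act. rewrite gmulA. reflexivity. Qed.

Lemma act_1 (z : Omega G) : act G 1 z = z.
Proof. extensionality h. unfold act. rewrite gmulg1. reflexivity. Qed.

Lemma closure_orbit_subshift (u : Omega G) : subshift G (closure G (orbit G u)).
Proof.
  split.
  - intros z Hz F. destruct (Hz F) as (s & Hs & Es). destruct (Hs F) as (t & Ht & Et).
    exists t. split; auto. intros h Hh. rewrite Et; auto.
  - intros g x Hx F. destruct (Hx (lmul F [g])) as (s & (k & ->) & Es).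
    exists (act G g (act G k u)). split.
    + exists (g * k). apply act_act.
    + intros h Hh. unfold act at 1 3. apply Es. apply in_lmul; simpl; auto.
Qed.

Lemma closure_orbit_self (u : Omega G) : closure G (orbit G u) u.
Proof. intros F. exists u. split; [exists 1; rewrite act_1|intros h _]; reflexivity. Qed.

Lemma closure_orbit_least (X : Omega G -> Prop) u :
  subshift G X -> X u -> forall x, closure G (orbit G u) x -> X x.
Proof.
  intros [Hc Hi] Hu x Hx. apply Hc. intros F. destruct (Hx F) as (s & (g & ->) & E).
  exists (act G g u). auto.
Qed.

Lemma closure_orbit_in (u y : Omega G) F :
  closure G (orbit G u) y -> exists g, agree_on G F (act G g u) y.
Proof. intros H. destruct (H F) as (s & (g & ->) & E). eauto. Qed.

(** * Compactness and uniform recurrence *)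

Variables (enum : nat -> G) (idx : G -> nat).
Hypothesis enumK : forall g, enum (idx g) = g.

Definition ball (n : nat) : list G := map enum (seq 0 n).

Lemma in_ball g n : (idx g < n)%nat -> In g (ball n).
Proof. intros H. apply in_map_iff. exists (idx g). rewrite in_seq. split; [auto|lia]. Qed.

Lemma idx_bounded (F : list G) : exists M, forall g, In g F -> (idx g < M)%nat.
Proof.
  induction F as [|a F (M & IH)].
  - exists 0%nat. intros g [].
  - exists (Nat.max M (S (idx a))). intros g [<-|Hg]; [lia|]. specialize (IH g Hg). lia.
Qed.

Lemma incl_ball (F : list G) : exists N, forall n, (N <= n)%nat -> incl F (ball n).
Proof.
  destruct (idx_bounded F) as (N & HN). exists N. intros n Hn g Hg.
  apply in_ball. specialize (HN g Hg). lia.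
Qed.

Definition unbounded (A : nat -> Prop) : Prop := forall N, exists n, (N <= n)%nat /\ A n.

(** The diagonal argument: an unbounded set of indices along which [s] is constant at each of
    [enum 0], ..., [enum (n - 1)], with [true] preferred whenever it recurs. *)
Fixpoint nest (s : nat -> Omega G) (n k : nat) : Prop :=
  match n with
  | O => True
  | S n' => nest s n' k /\
      (s k (enum n') = true <-> unbounded (fun j => nest s n' j /\ s j (enum n') = true))
  end.

Lemma nest_unbounded s n : unbounded (nest s n).
Proof.
  induction n as [|n IH]; simpl; [intros N; exists N; auto|].
  destruct (classic (unbounded (fun j => nest s n j /\ s j (enum n) = true))) as [H|H].
  - intros N. destruct (H N) as (k & ? & ? & ?). exists k. tauto.
  - intros N. apply not_all_ex_not in H. destruct H as (M & HM).
    destruct (IH (Nat.max N M)) as (k & Hk & Hn). exists k.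
    split; [lia|]. split; auto. split; intros Hs.
    + exfalso. apply HM. exists k. split; auto. lia.
    + exfalso. apply HM. destruct (Hs M) as (j & ? & ?). eauto.
Qed.

Lemma nest_le s n m k : (n <= m)%nat -> nest s m k -> nest s n k.
Proof. induction 1; simpl; tauto. Qed.

Lemma cluster_point (s : nat -> Omega G) :
  exists l : Omega G, forall F N, exists n, (N <= n)%nat /\ agree_on G F (s n) l.
Proof.
  exists (fun g => if excluded_middle_informative
    (unbounded (fun j => nest s (idx g) j /\ s j g = true)) then true else false).
  intros F N.
  destruct (idx_bounded F) as (M & HM). destruct (nest_unbounded s M N) as (k & Hk & Hn).
  exists k. split; auto. intros g Hg.
  assert (Hs : nest s (S (idx g)) k) by (apply (nest_le s _ M); auto; apply HM; auto).
  simpl in Hs. rewrite enumK in Hs. destruct Hs as [_ Hs].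
  destruct (excluded_middle_informative _) as [H|H]; [tauto|].
  destruct (s k g); tauto.
Qed.

(** If no ball worked, points of [X] that avoid the pattern of [c] along ever larger balls would
    cluster at a point of [X] whose orbit never comes close to [c]. *)
Lemma uniform_visits (X : Omega G -> Prop) (c : Omega G) (F : list G) :
  minimal_subshift G X -> X c ->
  exists Gamma, forall x, X x -> exists g, In g Gamma /\ agree_on G F (act G g x) c.
Proof.
  intros ((HXc & _) & _ & Hm) Hc. apply NNPP. intros Hn.
  assert (H : forall n, exists x, X x /\
    forall g, In g (ball n) -> ~ agree_on G F (act G g x) c).
  { intros n. apply NNPP. intros Hn'. apply Hn. exists (ball n). intros x Hx.
    apply NNPP. intros Hx'. apply Hn'. exists x. split; auto. eauto. }
  apply choice in H. destruct H as (s & Hs).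
  destruct (cluster_point s) as (x & Hx).
  assert (HX : X x).
  { apply HXc. intros F'. destruct (Hx F' 0%nat) as (n & _ & E).
    exists (s n). split; auto. apply Hs. }
  destruct (closure_orbit_in x c F (Hm x HX c Hc)) as (g & Hg).
  destruct (Hx (lmul F [g]) (S (idx g))) as (n & Hn' & E).
  destruct (Hs n) as [_ Hs']. apply (Hs' g).
  - apply in_ball. lia.
  - intros h Hh. rewrite <- Hg by auto. apply E. apply in_lmul; simpl; auto.
Qed.

(** A translate of [c] by some [h] outside [linv Gamma] times [l] visits [c] at some [g] in [Gamma],
    and then [g * h] is a return time outside [l]. *)
Lemma infinite_returns (X : Omega G -> Prop) (c : Omega G) (F : list G) :
  infinite_group G -> minimal_subshift G X -> X c ->
  forall l, exists d, agree_on G F (act G d c) c /\ ~ In d l.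
Proof.
  intros Hinf HX Hc l.
  destruct (uniform_visits X c F HX Hc) as (Gamma & HG).
  destruct (Hinf (lmul (linv Gamma) l)) as (h & Hh).
  destruct (HG (act G h c)) as (g & Hg & E).
  { apply HX; auto. }
  rewrite act_act in E. exists (g * h). split; auto.
  intros Hl. apply Hh. rewrite <- (gmulKg g h). auto using in_lmul, in_linv.
Qed.

(* The first [k] of the points [e i] are known when [z] is chosen, the others
   are not; the induction step trades knowledge of the point [e k] for the
   knowledge that some translate of it looks like a fixed [c] on [W]. *)
Definition avoidable (X : nat -> Omega G -> Prop) (r : (nat -> bool) -> bool -> Prop)
    (k : nat) : Prop :=
  exists W : list G, forall e : nat -> Omega G, (forall i, X i (e i)) ->
  exists z : Omega G, forall e' : nat -> Omega G, (forall i, X i (e' i)) ->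
    (forall i, (i < k)%nat -> e' i = e i) ->
    exists g, In g W /\ r (fun i => e' i g) (z g).

(** For every [s], let [P s] answer the guess that [e k] shifted by [s] is [c]. Some [g] in [Gamma]
    makes the actual point look like [c] on [lmul W D]. As every [d] in [D] is a return time of [c],
    the guess is right on [W] at each [d * g], and [z] shows [P (d * g)] at one of them. *)
Lemma avoidable_step X r k :
  infinite_group G -> (forall i, minimal_subshift G (X i)) ->
  avoidable X r (S k) -> avoidable X r k.
Proof.
  intros Hinf HX (W & HW).
  destruct (HX k) as (_ & (c & Hc) & _).
  destruct (prescribed_patterns (fun d => agree_on G W (act G d c) c) W
             (infinite_returns (X k) c W Hinf (HX k) Hc)) as (D & HD & Hz).
  destruct (uniform_visits (X k) c (lmul W D) (HX k) Hc) as (Gamma & HG).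
  exists (lmul W (lmul D Gamma)). intros e He.
  (* The entries beyond [k] are arbitrary: [e'] need not agree with them. *)
  set (known := fun s i => if Nat.eqb i k then c else act G s (e i)).
  assert (Hknown : forall s i, X i (known s i)).
  { intros s i. unfold known. destruct (Nat.eqb_spec i k) as [->|]; auto.
    apply HX; auto. }
  destruct (choice _ (fun s => HW (known s) (Hknown s))) as (P & HP).
  destruct (Hz Gamma (fun s w => P s w)) as (z & Hz'). exists z.
  intros e' He' Hk.
  destruct (HG (e' k) (He' k)) as (g & Hg & Eg).
  destruct (Hz' g Hg) as (d & Hd & Ez). set (s := d * g) in *.
  destruct (HP s (fun i => if Nat.eqb i k then c else act G s (e' i))) as (w & Hw & Hr).
  - intros i. destruct (Nat.eqb_spec i k) as [->|]; auto. apply HX; auto.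
  - intros i Hi. unfold known. destruct (Nat.eqb_spec i k); auto.
    rewrite Hk by lia. reflexivity.
  - exists (w * s). split; [unfold s; auto using in_lmul|].
    rewrite Ez by auto. replace (fun i => e' i (w * s)) with
      (fun i => (if Nat.eqb i k then c else act G s (e' i)) w); auto.
    extensionality i. destruct (Nat.eqb_spec i k) as [->|]; auto.
    rewrite <- (HD d Hd w Hw).
    assert (Eq := Eg (w * d) (in_lmul _ _ _ _ Hw Hd)).
    unfold act in *. unfold s. rewrite gmulA. auto.
Qed.

Lemma avoidable_0 X r k :
  infinite_group G -> (forall i, minimal_subshift G (X i)) ->
  avoidable X r k -> avoidable X r 0.
Proof. intros Hinf HX. induction k; auto. intros H. apply IHk, avoidable_step; auto. Qed.

(* Index [0] is reserved for [Y], the point that masks the comparison. *)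
Lemma masked_value_missed (Y : Omega G -> Prop) (X : nat -> Omega G -> Prop) (n : nat)
    (p : (nat -> bool) -> bool) :
  infinite_group G -> minimal_subshift G Y -> ~ Y (fun _ => false) ->
  (forall i, minimal_subshift G (X i)) ->
  (forall a b, (forall i, (i < n)%nat -> a i = b i) -> p a = p b) ->
  exists (W : list G) (z : Omega G), forall y e, Y y -> (forall i, X i (e i)) ->
    exists g, In g W /\ y g = true /\ p (fun i => e i g) <> z g.
Proof.
  intros Hinf HY H0 HX Hp.
  set (X' := fun i => match i with O => Y | S i => X i end).
  set (r := fun (a : nat -> bool) (b : bool) => a O = true /\ p (fun i => a (S i)) <> b).
  assert (HX' : forall i, minimal_subshift G (X' i)) by (intros [|i]; simpl; auto).
  (* With all relevant points known, the negation of [p] misses everywhere. It remains to find a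
     place where the mask is [true]: some [c] in [Y] has one, and every point of [Y] visits [c]
     within a bounded window. *)
  assert (Hav : avoidable X' r (S n)).
  { destruct HY as (HY & (c & Hc) & Hm).
    assert (Hh : exists h, c h = true).
    { apply NNPP. intros Hn. apply H0. replace (fun _ : G => false) with c; auto.
      extensionality h. destruct (c h) eqn:E; auto. exfalso; eauto. }
    destruct Hh as (h & Hh).
    destruct (uniform_visits Y c [h]) as (Gamma & HG); [split; eauto|auto|].
    exists (lmul [h] Gamma). intros e He.
    exists (fun g => negb (p (fun i => e (S i) g))). intros e' He' Hk.
    destruct (HG (e' O) (He' O)) as (g & Hg & E).
    exists (h * g). split; [apply in_lmul; simpl; auto|]. split.
    - rewrite <- Hh. rewrite <- E by (simpl; auto). reflexivity.
    - rewrite (Hp (fun i => e' (S i) (h * g)) (fun i => e (S i) (h * g))).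
      + destruct (p _); discriminate.
      + intros i Hi. rewrite Hk by lia. reflexivity. }
  apply avoidable_0 in Hav; auto. destruct Hav as (W & HW).
  (* At level [0] no agreement is demanded, so any starting family [e0] will do. *)
  destruct (choice _ (fun i => proj1 (proj2 (HX' i)))) as (e0 & He0).
  destruct (HW e0 He0) as (z & Hz). exists W, z. intros y e Hy He.
  destruct (Hz (fun i => match i with O => y | S i => e i end)) as (g & Hg & Hr).
  - intros [|i]; simpl; auto.
  - intros i Hi. lia.
  - exists g. split; auto.
Qed.

(** * Minimal subshifts as decreasing intersections *)

Lemma nested_limit (X : nat -> Omega G -> Prop) (s : nat -> Omega G) :
  (forall n, closed G (X n)) -> (forall n x, X (S n) x -> X n x) ->
  (forall n, X n (s n)) ->
  exists x, (forall n, X n x) /\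
    forall F N, exists n, (N <= n)%nat /\ agree_on G F (s n) x.
Proof.
  intros Hc Hd Hs. destruct (cluster_point s) as (x & Hx). exists x. split; auto.
  assert (Hle : forall n m y, (n <= m)%nat -> X m y -> X n y) by (induction 1; auto).
  intros n. apply Hc. intros F. destruct (Hx F n) as (m & Hm & E).
  exists (s m). split; eauto.
Qed.

Lemma finitely_many_patterns (W : list G) :
  exists Ps : list (Omega G), forall x, exists P, In P Ps /\ agree_on G W x P.
Proof.
  induction W as [|a W (Ps & IH)].
  - exists [fun _ => false]. intros x. exists (fun _ => false).
    split; [left; reflexivity|]. intros h Hh. destruct Hh.
  - exists (flat_map (fun P => [update G P a true; update G P a false]) Ps).
    intros x. destruct (IH x) as (P & HP & E). exists (update G P a (x a)). split.
    + apply in_flat_map. exists P. split; auto. destruct (x a); simpl; auto.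
    + intros h Hh. unfold update. destruct (eq_decide h a) as [->|Hne]; auto.
      apply E. destruct Hh; congruence.
Qed.

(** Either [P] is excluded or every orbit shows it. A decision survives passing to smaller sets, and
    a nonempty subshift with all patterns decided is minimal. *)
Definition decided (X : Omega G -> Prop) (W : list G) (P : Omega G) : Prop :=
  (forall x, X x -> ~ agree_on G W x P) \/
  (forall y, X y -> exists g, agree_on G W (act G g y) P).

Lemma decided_sub (X X' : Omega G -> Prop) W P :
  (forall x, X' x -> X x) -> decided X W P -> decided X' W P.
Proof. intros H [D|D]; [left|right]; auto. Qed.

Section Fusion.
Variable Good : (Omega G -> Prop) -> Prop.
Hypothesis Good_subshift : forall X, Good X -> subshift G X /\ exists x, X x.
Hypothesis Good_decide : forall X W P, Good X ->
  exists X', Good X' /\ (forall x, X' x -> X x) /\ decided X' W P.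

Lemma decide_list W Ps : forall X, Good X ->
  exists X', Good X' /\ (forall x, X' x -> X x) /\ forall P, In P Ps -> decided X' W P.
Proof.
  induction Ps as [|P Ps IH]; intros X HX.
  - exists X. simpl. tauto.
  - destruct (IH X HX) as (X1 & H1 & S1 & D1).
    destruct (Good_decide X1 W P H1) as (X2 & H2 & S2 & D2).
    exists X2. repeat split; auto. intros Q [<-|HQ]; auto.
    apply (decided_sub X1); auto.
Qed.

(** Stage [n] decides all patterns on [ball n]. The pattern of a point [y] of the intersection
    cannot be excluded, so every orbit in the intersection shows it. *)
Lemma fusion (X0 : Omega G -> Prop) : Good X0 ->
  exists X : nat -> Omega G -> Prop, X 0%nat = X0 /\ (forall n, Good (X n)) /\
    (forall n x, X (S n) x -> X n x) /\ minimal_subshift G (fun x => forall n, X n x).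
Proof.
  intros H0.
  (* [Good] is a premise under the existential so that [choice] yields a total function. *)
  assert (Hnext : forall nX : nat * (Omega G -> Prop), exists X', Good (snd nX) ->
    Good X' /\ (forall x, X' x -> snd nX x) /\
    forall x, exists P, agree_on G (ball (fst nX)) x P /\ decided X' (ball (fst nX)) P).
  { intros (n & X). simpl. destruct (classic (Good X)) as [HX|HX].
    - destruct (finitely_many_patterns (ball n)) as (Ps & HPs).
      destruct (decide_list (ball n) Ps X HX) as (X' & H & S' & D').
      exists X'. repeat split; auto. intros x. destruct (HPs x) as (P & ? & ?). eauto.
    - exists X. tauto. }
  apply choice in Hnext. destruct Hnext as (next & Hnext).
  set (X := fix X n := match n with O => X0 | S n' => next (n', X n') end).
  assert (HG : forall n, Good (X n)).
  { induction n as [|n IH]; auto. destruct (Hnext (n, X n) IH) as (H & _). exact H. }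
  assert (Hdec : forall n x, X (S n) x -> X n x).
  { intros n. destruct (Hnext (n, X n) (HG n)) as (_ & H & _). exact H. }
  exists X. repeat split; auto.
  - intros z Hz n. apply (Good_subshift (X n)); auto.
    intros F. destruct (Hz F) as (s & Hs & E). eauto.
  - intros g x Hx n. apply (Good_subshift (X n)); auto.
  - destruct (choice _ (fun n => proj2 (Good_subshift (X n) (HG n)))) as (s & Hs).
    destruct (nested_limit X s) as (x & Hx & _); eauto.
    intros n. apply (Good_subshift (X n)); auto.
  - intros x Hx y Hy F. destruct (incl_ball F) as (n & Hn).
    destruct (Hnext (n, X n) (HG n)) as (_ & _ & HP).
    destruct (HP y) as (P & EP & [D|D]); simpl in *.
    + exfalso. apply (D y); auto. apply (Hy (S n)).
    + destruct (D x (Hx (S n))) as (g & Eg). exists (act G g x). split; [exists g; auto|].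
      intros h Hh. assert (In h (ball n)) by (apply (Hn n); auto).
      rewrite EP, Eg; auto.
Qed.
End Fusion.

(** To decide [P], discard all points whose orbit shows it; if nothing remains, every orbit shows
    it. *)
Lemma minimal_subshift_exists (Z : Omega G -> Prop) :
  subshift G Z -> (exists z, Z z) ->
  exists X, minimal_subshift G X /\ forall x, X x -> Z x.
Proof.
  intros HZ Hne.
  destruct (fusion (fun X => (subshift G X /\ exists x, X x) /\ forall x, X x -> Z x))
    with (X0 := Z) as (X & H0 & HX & _ & Hm); auto; [tauto| |].
  - intros X W P ((HX & Hn) & HXZ).
    set (X' := fun x => X x /\ forall g, ~ agree_on G W (act G g x) P).
    destruct (classic (exists x, X' x)) as [H|H].
    + exists X'. repeat split; auto.
      * apply HX. intros F. destruct (H0 F) as (s & (Hs & _) & E). eauto.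
      * intros g Eg. destruct (H0 (lmul W [g])) as (s & (_ & Hs) & E).
        apply (Hs g). intros h Hh. rewrite <- Eg by auto.
        apply E. apply in_lmul; simpl; auto.
      * apply HX. apply H0.
      * intros h. rewrite act_act. apply H0.
      * intros x Hx. apply HXZ, Hx.
      * intros x Hx. apply Hx.
      * left. intros x (_ & Hx). rewrite <- (act_1 x). apply Hx.
    + exists X. repeat split; auto; try apply HX. right. intros y Hy. apply NNPP.
      intros Hg. apply H. exists y. split; auto. eauto.
  - exists (fun x => forall n, X n x). split; auto. intros x Hx. rewrite <- H0. apply Hx.
Qed.

(** Otherwise translates of [B] that meet [F] shifted by every [d] in larger and larger balls
    cluster at a point of [Z]. A minimal subflow of [Z] then contains the zero point by smallness,
    which [Z] forbids. *)
Lemma small_syndetic (B : Omega G) (F : list G) : small G B ->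
  exists E, forall g, exists d, In d E /\ forall h, In h F -> B (h * (d * g)) = false.
Proof.
  intros HB. apply NNPP. intros Hn.
  assert (Hg : forall n, exists g, forall d, In d (ball n) ->
                 exists h, In h F /\ B (h * (d * g)) = true).
  { intros n. apply NNPP. intros Hn'. apply Hn. exists (ball n). intros g.
    apply NNPP. intros Hd. apply Hn'. exists g. intros d Hin. apply NNPP. intros Hh.
    apply Hd. exists d. split; auto. intros h Hh'.
    destruct (B (h * (d * g))) eqn:E; auto. exfalso; eauto. }
  apply choice in Hg. destruct Hg as (g & Hg).
  set (Z := fun y => closure G (orbit G B) y /\ forall d, exists h, In h F /\ y (h * d) = true).
  destruct (closure_orbit_subshift B) as [Hcl Hinv].
  assert (HZ : subshift G Z).
  { split.
    - intros z Hz. split.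
      + apply Hcl. intros F'. destruct (Hz F') as (s & (Hs & _) & E). eauto.
      + intros d. destruct (Hz (lmul F [d])) as (s & (_ & Hs) & E).
        destruct (Hs d) as (h & Hh & Es). exists h. split; auto. rewrite <- E; auto.
        apply in_lmul; simpl; auto.
    - intros a x (Hx & Hd). split; auto. intros d. destruct (Hd (d * a)) as (h & Hh & E).
      exists h. split; auto. unfold act. rewrite <- gmulA. auto. }
  destruct (cluster_point (fun n => act G (g n) B)) as (y & Hy).
  destruct (minimal_subshift_exists Z HZ) as (X & HX & HXZ).
  { exists y. split.
    - intros F'. destruct (Hy F' 0%nat) as (n & _ & E). eexists. split; [eexists|]; eauto.
    - intros d. destruct (Hy (lmul F [d]) (S (idx d))) as (n & Hn' & E).
      destruct (Hg n d) as (h & Hh & Eh); [apply in_ball; lia|].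
      exists h. split; auto. rewrite <- E by (apply in_lmul; simpl; auto).
      unfold act. rewrite <- gmulA. auto. }
  assert (H0 : X (fun _ => false)).
  { apply (HB X); auto. intros x Hx. apply HXZ; auto. }
  destruct (HXZ _ H0) as (_ & Hd). destruct (Hd 1) as (h & _ & E). discriminate.
Qed.

(** Greedy choice along [enum]: [g] is chosen at its turn unless an earlier choice is already
    similar to it. *)
Lemma maximal_separated (E : G -> Prop) (sim : G -> G -> Prop) :
  (forall g, sim g g) -> (forall g h, sim g h -> sim h g) ->
  exists S : G -> Prop, (forall s, S s -> E s) /\
    (forall s t, S s -> S t -> sim s t -> s = t) /\
    forall g, E g -> exists s, S s /\ sim g s.
Proof.
  intros Hr Hs.
  set (greedy := fix greedy n : G -> Prop := match n with
    | O => fun _ => False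
    | S n' => fun g => greedy n' g \/
        (g = enum n' /\ E g /\ forall s, greedy n' s -> ~ sim g s) end).
  assert (Hle : forall n m g, (n <= m)%nat -> greedy n g -> greedy m g).
  { induction 1; simpl; auto. }
  assert (Hsep : forall n s t, greedy n s -> greedy n t -> sim s t -> s = t).
  { induction n as [|n IH]; simpl; [tauto|].
    intros s t [Hs'|(-> & _ & Hs')] [Ht|(-> & _ & Ht)] H; auto.
    - exfalso. apply (Ht s); auto.
    - exfalso. apply (Hs' t); auto. }
  exists (fun g => exists n, greedy n g). repeat split.
  - intros s (n & H). induction n; simpl in H; tauto.
  - intros s t (n & Hn) (m & Hm). apply (Hsep (Nat.max n m)).
    + apply (Hle n); auto. lia.
    + apply (Hle m); auto. lia.
  - intros g Hg. destruct (classic (exists s, greedy (idx g) s /\ sim g s)) as [(s & ? & ?)|H].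
    + eauto.
    + exists g. split; auto. exists (S (idx g)). simpl. right.
      rewrite enumK. repeat split; auto. intros s Hs' H'. apply H; eauto.
Qed.

(** * Strongly irreducible subshifts *)

(* Strong irreducibility: [r g y] prescribes that the value at [g] be copied
   from [y], and distinct points of [X] may be prescribed on [K]-separated sets. *)
Definition gluing (K : list G) (X : Omega G -> Prop) : Prop :=
  forall r : G -> Omega G -> Prop,
    (forall g y, r g y -> X y) ->
    (forall g h y y' k k', r g y -> r h y' -> In k K -> In k' K -> k * g = k' * h -> y = y') ->
    exists x, X x /\ forall g y, r g y -> x g = y g.

Lemma gluing_full : gluing [1] (fun _ => True).
Proof.
  intros r _ Hr.
  exists (fun g => if excluded_middle_informative (exists y, r g y /\ y g = true)
                   then true else false).
  split; auto. intros g y H. destruct (excluded_middle_informative _) as [(y' & H' & E)|Hn].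
  - rewrite (Hr g g y y' 1 1); simpl; auto.
  - destruct (y g) eqn:E; auto. exfalso; eauto.
Qed.

(** With [KW = lmul K W] this says that there is room at [g] for a further pattern on [W]. *)
Definition far (KW K : list G) (r : G -> Omega G -> Prop) (g : G) : Prop :=
  forall h y k k', r h y -> In k KW -> In k' K -> k * g <> k' * h.

(** Copies of [q] are placed at a maximal family of far points whose [KW]-windows are disjoint. By
    maximality, the window of any far point meets the window of a chosen one. *)
Lemma gluing_insert K W X (q : Omega G) r :
  subshift G X -> gluing K X -> In 1 K -> In 1 W -> X q ->
  (forall g y, r g y -> X y) ->
  (forall g h y y' k k', r g y -> r h y' -> In k K -> In k' K -> k * g = k' * h -> y = y') ->
  exists x, X x /\ (forall g y, r g y -> x g = y g) /\
    forall g, far (lmul K W) K r g ->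
      exists d, In d (lmul (linv (lmul K W)) (lmul K W)) /\ agree_on G W (act G (d * g) x) q.
Proof.
  intros [HXc HXi] HK H1K H1W Hq HrX Hr. set (KW := lmul K W).
  assert (H1 : In 1 KW).
  { rewrite <- (gmul1g G 1). apply in_lmul; auto. }
  destruct (maximal_separated (far KW K r)
    (fun g h => exists k k', In k KW /\ In k' KW /\ k * g = k' * h)) as (S & HSE & HSs & HSm).
  { intros g. exists 1, 1. auto. }
  { intros g h (k & k' & ? & ? & ?). exists k', k. auto. }
  (* The single point [act G (s^-1) q] serves the whole copy at [s], so only distinct copies have to
     be separated. *)
  set (r' := fun h y => r h y \/
    exists s w, S s /\ In w W /\ h = w * s /\ y = act G (s^-1) q).
  destruct (HK r') as (x & Hx & Hxr).
  - intros g y [H|(s & w & _ & _ & _ & ->)]; eauto.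
  - intros g h y y' k k' [H|(s & w & Hs & Hw & -> & ->)]
      [H'|(s' & w' & Hs' & Hw' & -> & ->)] Hk Hk' E.
    + apply (Hr g h y y' k k'); auto.
    + exfalso. apply (HSE s' Hs' g y (k' * w') k); auto; [apply in_lmul; auto|].
      rewrite <- gmulA. auto.
    + exfalso. apply (HSE s Hs h y' (k * w) k'); auto; [apply in_lmul; auto|].
      rewrite <- gmulA. auto.
    + replace s' with s; auto. apply HSs; auto.
      exists (k * w), (k' * w'). rewrite <- !gmulA. repeat split; auto; apply in_lmul; auto.
  - exists x. repeat split; auto.
    + intros g y H. apply Hxr. left; auto.
    + intros g Hg. destruct (HSm g Hg) as (s & Hs & k & k' & Hk & Hk' & E).
      exists (k'^-1 * k). split; [auto using in_lmul, in_linv|].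
      rewrite <- gmulA, E, gmulKg. intros w Hw. unfold act at 1.
      rewrite (Hxr (w * s) (act G (s^-1) q)).
      * unfold act. rewrite gmulgK. reflexivity.
      * right. exists s, w. auto.
Qed.

Definition returns_within (D W : list G) (q : Omega G) (X : Omega G -> Prop) (x : Omega G)
  : Prop := X x /\ forall g, exists d, In d D /\ agree_on G W (act G (d * g) x) q.

Lemma returns_within_subshift D W q X :
  subshift G X -> subshift G (returns_within D W q X).
Proof.
  intros [HXc HXi]. split.
  - intros z Hz. split.
    + apply HXc. intros F. destruct (Hz F) as (s & (Hs & _) & E). eauto.
    + intros g. destruct (Hz (lmul W (lmul D [g]))) as (s & (_ & Hs) & E).
      destruct (Hs g) as (d & Hd & Ed). exists d. split; auto. intros h Hh.
      rewrite <- Ed by auto. symmetry. apply E.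
      apply in_lmul; auto. apply in_lmul; simpl; auto.
  - intros a x (Hx & Hd). split; auto. intros g. destruct (Hd (g * a)) as (d & Hin & E).
    exists d. split; auto. rewrite act_act, <- gmulA. auto.
Qed.

(* Around each prescribed piece all its nearby occurrences of [q] are prescribed
   too; wherever [q] is still missing there is room to insert it. *)
Lemma returns_within_gluing K W D q X :
  subshift G X -> gluing K X -> In 1 K -> In 1 W -> X q ->
  incl (lmul (linv (lmul K W)) (lmul K W)) D ->
  exists K', In 1 K' /\ gluing K' (returns_within D W q X).
Proof.
  intros HX HK H1K H1W Hq HD. set (KW := lmul K W) in *.
  (* If [g] is too close to a prescribed [g0], then [g] lies in [linv KW] times [K] times [g0], and
     the occurrences of [q] at [D] times [g] lie in [L] times [g0]. *)
  set (L := lmul D (lmul (linv KW) K)).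
  exists (K ++ lmul K (lmul W L)). split; [apply in_or_app; auto|].
  intros r HrX Hr.
  set (rp := fun h y => exists g, r g y /\ (h = g \/
     exists l w, In l L /\ agree_on G W (act G (l * g) y) q /\ In w W /\ h = w * (l * g))).
  (* The enlarged pieces stay [K]-separated because the new separation set absorbs the
     enlargement. *)
  assert (Hrp : forall h y, rp h y -> exists g, r g y /\ forall k, In k K ->
     exists k', In k' (K ++ lmul K (lmul W L)) /\ k * h = k' * g).
  { intros h y (g & Hg & [->|(l & w & Hl & _ & Hw & ->)]); exists g; split; auto; intros k Hk.
    - exists k. split; auto. apply in_or_app; auto.
    - exists (k * (w * l)). rewrite <- !gmulA. split; auto.
      apply in_or_app; auto using in_lmul. }
  destruct (gluing_insert K W X q rp) as (x & Hx & Hxr & Hxd); auto.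
  - intros h y (g & Hg & _). apply (HrX g y Hg).
  - intros h h' y y' k k' H H' Hk Hk' E.
    destruct (Hrp h y H) as (g & Hg & Hu). destruct (Hrp h' y' H') as (g' & Hg' & Hu').
    destruct (Hu k Hk) as (u & Hu1 & Hu2). destruct (Hu' k' Hk') as (u' & Hu1' & Hu2').
    apply (Hr g g' y y' u u'); auto. congruence.
  - exists x. split.
    2:{ intros g y H. apply Hxr. exists g. auto. }
    assert (Hocc : forall l g y, r g y -> In l L -> agree_on G W (act G (l * g) y) q ->
      agree_on G W (act G (l * g) x) q).
    { intros l g y Hg Hl E w Hw. rewrite <- E by auto. unfold act. apply Hxr.
      exists g. split; auto. right. exists l, w. auto. }
    split; auto. intros g. destruct (classic (far KW K rp g)) as [Hf|Hf].
    { destruct (Hxd g Hf) as (d & Hd & E). eauto. }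
    unfold far in Hf.
    apply not_all_ex_not in Hf. destruct Hf as (h & Hf).
    apply not_all_ex_not in Hf. destruct Hf as (y & Hf).
    apply not_all_ex_not in Hf. destruct Hf as (k & Hf).
    apply not_all_ex_not in Hf. destruct Hf as (k' & Hf).
    apply imply_to_and in Hf. destruct Hf as (Hh & Hf).
    apply imply_to_and in Hf. destruct Hf as (Hk & Hf).
    apply imply_to_and in Hf. destruct Hf as (Hk' & Hf). apply NNPP in Hf.
    (* Either an original prescription is near, and its point [y] has an occurrence near [g] that
       was copied, or a copied occurrence is itself near [g]. *)
    destruct Hh as (g0 & Hg0 & [->|(l & w & Hl & E & Hw & ->)]).
    + destruct (HrX g0 y Hg0) as (_ & Hy). destruct (Hy g) as (d & Hd & E).
      exists d. split; auto.
      assert (Ed : d * g = d * (k^-1 * k') * g0).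
      { rewrite <- !gmulA, <- Hf, gmulKg. reflexivity. }
      rewrite Ed in E |- *. apply (Hocc _ _ y); auto. unfold L. auto using in_lmul, in_linv.
    + exists ((k' * w)^-1 * k). split.
      * apply HD, in_lmul; auto. apply in_linv, in_lmul; auto.
      * rewrite <- gmulA, Hf, (gmulA G k' w), gmulKg. apply (Hocc _ _ y); auto.
Qed.

Lemma small_shattered (B : Omega G) : small G B ->
  exists X, minimal_subshift G X /\ shatters G X B.
Proof.
  intros HB.
  destruct (fusion (fun X => subshift G X /\ shatters G X B /\ exists K, In 1 K /\ gluing K X))
    with (X0 := fun _ : Omega G => True) as (X & _ & HX & Hd & Hm).
  - intros X (HX & HS & _). split; auto.
    destruct (HS (fun _ => false)) as (x & Hx & _); [discriminate|eauto].
  - intros X W P (HX & HS & K & H1K & HK).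
    destruct (classic (exists q, X q /\ agree_on G W q P)) as [(q & Hq & Eq)|Hn].
    2:{ exists X. split; [eauto|]. split; auto. left. intros x Hx E. eauto. }
    (* Recurrence of [q] on the larger [W1] also yields the pattern [P] on [W]. *)
    set (W1 := 1 :: W). set (KW := lmul K W1). set (M := lmul (linv KW) KW).
    (* Within [E] of any [g] there is a point far from [B], and within [M] of that point a copy of
       [q] gets inserted; hence [lmul M E] in [D]. *)
    destruct (small_syndetic B (lmul (linv K) KW) HB) as (E & HE).
    set (D := M ++ lmul M E). exists (returns_within D W1 q X). split; [|split].
    + split; [apply returns_within_subshift; auto|]. split.
      * intros C HC. destruct (HS C HC) as (x1 & Hx1 & E1).
        destruct (gluing_insert K W1 X q (fun h y => B h = true /\ y = x1))
          as (x & Hx & Hxr & Hxd); auto; [simpl; auto|intros g y (_ & ->); auto| |].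
        { intros g h y y' k k' (_ & ->) (_ & ->). auto. }
        exists x. split.
        -- split; auto. intros g. destruct (HE g) as (d & Hd & Hg).
           destruct (Hxd (d * g)) as (d' & Hd' & E').
           ++ intros h y k k' (Hh & _) Hk Hk' Eh.
              assert (Hf := Hg (k'^-1 * k)). rewrite <- gmulA, Eh, gmulKg in Hf.
              rewrite Hf in Hh; [discriminate|auto using in_lmul, in_linv].
           ++ exists (d' * d). rewrite <- gmulA. split; auto.
              apply in_or_app. auto using in_lmul.
        -- intros h Hh. rewrite (Hxr h x1); auto.
      * apply (returns_within_gluing K); auto; [simpl; auto|].
        intros d Hd. apply in_or_app; auto.
    + intros x Hx. apply Hx.
    + right. intros y (_ & Hy). destruct (Hy 1) as (d & _ & Ed). exists (d * 1).
      intros h Hh. rewrite Ed by (simpl; auto). auto.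
  - repeat split; auto.
    + intros C HC. exists C. auto.
    + exists [1]. split; [simpl; auto|apply gluing_full].
  - exists (fun x => forall n, X n x). split; auto. intros C HC.
    destruct (choice _ (fun n => proj1 (proj2 (HX n)) C HC)) as (s & Hs).
    destruct (nested_limit X s) as (x & Hx & Ex); auto.
    { intros n. apply HX. }
    { intros n. apply Hs. }
    exists x. split; auto. intros h Hh.
    destruct (Ex [h] 0%nat) as (n & _ & En). rewrite <- En by (simpl; auto).
    apply Hs; auto.
Qed.

(** * Sets shattered by the ring are small *)

Lemma closure_orbit_false (x : Omega G) :
  closure G (orbit G (fun _ => false)) x -> x = (fun _ => false).
Proof.
  intros H. extensionality h. destruct (closure_orbit_in _ x [h] H) as (g & E).
  symmetry. apply (E h). simpl; auto.
Qed.

Lemma minimal_point_false : minimal_point G (fun _ => false).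
Proof.
  split; [apply closure_orbit_subshift|]. split.
  - eexists. apply closure_orbit_self.
  - intros x Hx y Hy. apply closure_orbit_false in Hx, Hy. subst. apply closure_orbit_self.
Qed.

Lemma minimal_subshift_point (X : Omega G -> Prop) x :
  minimal_subshift G X -> X x -> minimal_point G x.
Proof.
  intros (HX & _ & Hm) Hx. split; [apply closure_orbit_subshift|]. split.
  - exists x. apply closure_orbit_self.
  - intros a Ha b Hb. apply Hm; eapply closure_orbit_least; eauto.
Qed.

(** A Boolean polynomial in [n] minimal points, the list of points being padded to a sequence. *)
Definition function_of_minimal_points (x : Omega G) : Prop :=
  exists (n : nat) (u : nat -> Omega G) (p : (nat -> bool) -> bool),
    (forall i, minimal_point G (u i)) /\
    (forall a b, (forall i, (i < n)%nat -> a i = b i) -> p a = p b) /\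
    forall g, x g = p (fun i => u i g).

Lemma function_of_minimal_points_combine (op : bool -> bool -> bool) x y :
  function_of_minimal_points x -> function_of_minimal_points y ->
  function_of_minimal_points (fun g => op (x g) (y g)).
Proof.
  intros (n & u & p & Hu & Hp & Hx) (m & v & q & Hv & Hq & Hy).
  exists (n + m)%nat, (fun i => if Nat.ltb i n then u i else v (i - n)%nat),
    (fun a => op (p a) (q (fun i => a (n + i)%nat))).
  split; [|split].
  - intros i. destruct (Nat.ltb i n); auto.
  - intros a b Hab. f_equal; [apply Hp|apply Hq]; intros i Hi; apply Hab; lia.
  - intros g. rewrite Hx, Hy. f_equal.
    + apply Hp. intros i Hi. apply Nat.ltb_lt in Hi. rewrite Hi. reflexivity.
    + apply Hq. intros i Hi. replace (Nat.ltb (n + i) n) with false.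
      * replace (n + i - n)%nat with i by lia. reflexivity.
      * symmetry. apply Nat.ltb_ge. lia.
Qed.

Lemma frakB_function_of_minimal_points x : frakB G x -> function_of_minimal_points x.
Proof.
  induction 1 as [u Hu| | |x y _ IHx _ IHy|x y _ IHx _ IHy].
  - exists 1%nat, (fun _ => u), (fun a => a O).
    auto.
  - exists O, (fun _ _ => false), (fun _ => false). split; auto.
    intros _. apply minimal_point_false.
  - exists O, (fun _ _ => false), (fun _ => true). split; auto.
    intros _. apply minimal_point_false.
  - apply (function_of_minimal_points_combine xorb); auto.
  - apply (function_of_minimal_points_combine andb); auto.
Qed.

(** * A generic subset of a set that is not small *)

Lemma testbit_prescribed (N : nat) : forall b : nat -> bool,
  exists c, forall i, (i < N)%nat -> Nat.testbit c i = b i.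
Proof.
  induction N as [|N IH]; intros b.
  - exists O. intros i Hi. lia.
  - destruct (IH (fun i => b (S i))) as (c & Hc).
    exists (if b O then 2 * c + 1 else 2 * c)%nat. intros [|i] Hi.
    + destruct (b O) eqn:E; [apply Nat.testbit_odd_0|apply Nat.testbit_even_0].
    + rewrite <- Hc by lia. destruct (b O).
      * apply Nat.testbit_odd_succ. lia.
      * apply Nat.testbit_even_succ. lia.
Qed.

(** The binary digits of the first component of [n] code a pattern; the second component makes every
    pattern recur at arbitrarily large [n]. *)
Definition dense_seq (n : nat) : Omega G :=
  fun g => Nat.testbit (fst (Cantor.of_nat n)) (idx g).

Lemma dense_seq_agree W (z : Omega G) N :
  exists n, (N <= n)%nat /\ agree_on G W (dense_seq n) z.
Proof.
  destruct (idx_bounded W) as (M & HM).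
  destruct (testbit_prescribed M (fun i => z (enum i))) as (c & Hc).
  exists (Cantor.to_nat (c, N)). split.
  - pose proof (Cantor.to_nat_non_decreasing c N). lia.
  - intros g Hg. unfold dense_seq. rewrite Cantor.cancel_of_to. simpl.
    rewrite Hc, enumK; auto.
Qed.

(** The place where [B] looks like [y] cannot be chosen, so [y] is copied on [W] times more than
    [length L] translates [h]; at most [length L] of the windows at [h * g] can meet [used]. *)
Lemma fresh_window (B y : Omega G) (W used : list G) :
  infinite_group G -> closure G (orbit G B) y ->
  exists g h, agree_on G W (act G g B) (act G h y) /\
    forall w, In w W -> ~ In (w * g) used.
Proof.
  intros Hinf Hy. set (L := lmul (linv W) used).
  (* The empty window makes this a mere supply of distinct elements. *)
  destruct (spread_out (fun _ => True) [] (S (length L))) as (H & Hl & Hn & _).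
  { intros l. destruct (Hinf l) as (g & Hg). eauto. }
  destruct (closure_orbit_in B y (lmul W H) Hy) as (g & Hg).
  assert (Hh : exists h, In h H /\ ~ In h (lmul L [g^-1])).
  { apply NNPP. intros Hh.
    assert (Hi : incl H (lmul L [g^-1])).
    { intros h Hin. apply NNPP. intros Hh'. apply Hh. eauto. }
    apply NoDup_incl_length in Hi; auto. rewrite length_lmul in Hi. simpl in Hi. lia. }
  destruct Hh as (h & Hh & Hnew). exists (h * g), h. split.
  - intros w Hw. rewrite <- act_act. unfold act at 1 3. apply Hg. apply in_lmul; auto.
  - intros w Hw Hu. apply Hnew. rewrite <- (gmulgK h g).
    apply in_lmul; [|simpl; auto]. rewrite <- (gmulKg w (h * g)).
    apply in_lmul; auto using in_linv.
Qed.

(** Stage [n] writes [dense_seq n], cut down to [B], on a fresh copy of [ball n] where [B] looks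
    like a translate of [y]. The copies are disjoint, so the stages do not interfere. *)
Lemma generic_subset (B y : Omega G) :
  infinite_group G -> closure G (orbit G B) y ->
  exists C : Omega G, (forall h, C h = true -> B h = true) /\
    forall W z, exists g h, agree_on G W (act G g B) (act G h y) /\
      forall w, In w W -> B (w * g) = true -> C (w * g) = z w.
Proof.
  intros Hinf Hy.
  destruct (choice _ (fun un : list G * nat => fresh_window B y (ball (snd un)) (fst un) Hinf Hy))
    as (pick & Hpick).
  set (used := fix used n := match n with
    | O => [] | S n' => lmul (ball n') [pick (used n', n')] ++ used n' end).
  set (gs := fun n => pick (used n, n)).
  assert (Hused : forall n m w, (n < m)%nat -> In w (ball n) -> In (w * gs n) (used m)).
  { intros n m w Hnm Hw. induction Hnm; simpl; apply in_or_app; auto.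
    left. apply in_lmul; simpl; auto. }
  assert (Hnew : forall n w, In w (ball n) -> ~ In (w * gs n) (used n)).
  { intros n w Hw. destruct (Hpick (used n, n)) as (h & _ & Hp). apply Hp; auto. }
  assert (Huniq : forall n m w w', In w (ball n) -> In w' (ball m) ->
    w * gs n = w' * gs m -> n = m /\ w = w').
  { intros n m w w' Hw Hw' E. destruct (Nat.lt_trichotomy n m) as [H|[<-|H]].
    - exfalso. apply (Hnew m w' Hw'). rewrite <- E. auto.
    - split; auto. apply (gmulIg w w' (gs n)); auto.
    - exfalso. apply (Hnew n w Hw). rewrite E. auto. }
  set (inC := fun h => B h = true /\
    exists n w, In w (ball n) /\ h = w * gs n /\ dense_seq n w = true).
  exists (fun h => if excluded_middle_informative (inC h) then true else false). split.
  - intros h. destruct (excluded_middle_informative _) as [H|]; [|discriminate].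
    intros _. apply H.
  - intros W z. destruct (incl_ball W) as (N & HN).
    destruct (dense_seq_agree W z N) as (n & Hn & Ez).
    destruct (Hpick (used n, n)) as (h & Hh & _). exists (gs n), h. split.
    + intros w Hw. apply Hh. apply (HN n); auto.
    + intros w Hw HB. rewrite <- Ez by auto.
      assert (Hb : In w (ball n)) by (apply (HN n); auto).
      destruct (excluded_middle_informative _) as [(_ & m & w' & Hw' & E & Ed)|H].
      * destruct (Huniq n m w w') as [<- <-]; auto.
      * destruct (dense_seq n w) eqn:E; auto. exfalso. apply H. split; eauto.
Qed.

(** On the window where [C] shows the masked [z], an element [x] of the ring that agrees with [C] on
    [B] would equal [z] wherever the translate of [y] is [true], against [masked_value_missed]. *)
Lemma shattered_small (B : Omega G) :
  infinite_group G -> shatters G (frakB G) B -> small G B.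
Proof.
  intros Hinf Hsh Y HYB HY.
  destruct (classic (Y (fun _ => false))) as [H0|H0].
  { intros x. split; [|intros ->; auto]. intros Hx.
    apply closure_orbit_false, HY; auto. }
  exfalso. destruct HY as (HYs & (y & Hy) & HYm).
  destruct (generic_subset B y Hinf (HYB y Hy)) as (C & HCB & HC).
  destruct (Hsh C HCB) as (x & Hx & HxC).
  destruct (frakB_function_of_minimal_points x Hx) as (n & u & p & Hu & Hp & Hxp).
  destruct (masked_value_missed Y (fun i => closure G (orbit G (u i))) n p)
    as (W & z & HW); auto; [split; eauto|].
  destruct (HC W z) as (g & h & Eg & Cg).
  destruct (HW (act G h y) (fun i => act G g (u i))) as (w & Hw & Hyw & Hz).
  - apply HYs; auto.
  - intros i. apply closure_orbit_subshift, closure_orbit_self.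
  - assert (HBw : B (w * g) = true) by (rewrite <- Hyw; apply (Eg w Hw)).
    apply Hz. rewrite <- (Cg w Hw HBw), <- HxC by auto. symmetry. apply Hxp.
Qed.

End Dynamics.

Theorem theorem10p2 (G : group) (Hc : countable_group G) (Hi : infinite_group G)
  (B : Omega G) :
  (shatters G (frakB G) B <-> small G B) /\
  (small G B -> exists X : Omega G -> Prop,
      minimal_subshift G X /\ shatters G X B).
Proof.
  destruct Hc as (enum & Henum). apply choice in Henum. destruct Henum as (idx & Hidx).
  assert (Hs : small G B -> exists X, minimal_subshift G X /\ shatters G X B)
    by (apply (small_shattered G enum idx Hidx)).
  split; auto. split.
  - apply (shattered_small G enum idx Hidx); auto.
  - intros HB. destruct (Hs HB) as (X & HX & HXB). intros C HC.
    destruct (HXB C HC) as (x & Hx & E). exists x. split; auto.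
    apply frakB_gen, (minimal_subshift_point G X); auto.
Qed.
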